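(* Let $A$ be an orthogonal matrix of order $4$ that is a real linear combination of three distinct permutation matrices of order $4$. Then either $A$ or $-A$ is a permutation matrix, or there exist permutation matrices $X,Y$ of order $4$ such that $XAY$ is a direct sum (block diagonal matrix) of orthogonal permutative matrices of orders $3$ and $1$.
   Context: A matrix is permutative if each of its rows is a permutation of any other row; an orthogonal permutative matrix is a permutative matrix $B$ with $B^TB=I$. *)

(* Defs.v *)
From HB Require Import structures.
From mathcomp Require Import all_boot all_order all_algebra all_fingroup.
From mathcomp Require Import reals.

Set Implicit Arguments.
Unset Strict Implicit.
Unset Printing Implicit Defensive.

Import Order.TTheory GRing.Theory Num.Theory.
Local Open Scope ring_scope.

Definition orthogonal_mx (R : realType) (n : nat) (A : 'M[R]_n) : Prop :=
  A^T *m A = 1%:M.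

Definition permutative_mx (R : realType) (n : nat) (A : 'M[R]_n) : Prop :=
  forall i k : 'I_n, exists s : 'S_n, row i A = col_perm s (row k A).

Definition orthogonal_permutative_mx (R : realType) (n : nat) (A : 'M[R]_n) :
  Prop := permutative_mx A /\ orthogonal_mx A.

(* Main.v *)
(** Write [A = a P1 + b P2 + c P3] with permutations [s1, s2, s3].  Evaluating
    [A] on the all-ones vector gives [(a + b + c)^2 = 1], which makes every
    entry of [A A^T = I] a linear condition on [u = ab, v = ac, w = bc].  If
    [abc = 0], then [A] is plus or minus a permutation matrix.  Otherwise a row
    in which [s1, s2, s3] take three distinct values gives [u + v + w = 0],
    while a row in which exactly two of the values agree makes a sum of two of
    [u, v, w] vanish, so the two kinds of row exclude each other.  Without rows
    of the first kind, two of the coefficients are the opposite of the third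
    and each row of [A] has a single nonzero entry.  Not all rows can be of the
    first kind: take the column [m] avoided by row 0 and compare row 0 with
    another row, which must reach [m].  Hence some row has
    [s1 = s2 = s3]; it is unique, and the other three rows form a 3 x 3 Latin
    square in [a, b, c]. *)

Require Import Defs.
From HB Require Import structures.
From mathcomp Require Import all_boot all_order all_algebra all_fingroup.
From mathcomp Require Import reals ring lra.

Set Implicit Arguments.
Unset Strict Implicit.
Unset Printing Implicit Defensive.

Import Order.TTheory GRing.Theory Num.Theory.
Local Open Scope ring_scope.

(** * Combinations of three permutation matrices and their row relations *)

Definition comb3 (R : realType) n (a b c : R) (s1 s2 s3 : 'S_n) : 'M[R]_n :=
  a *: perm_mx s1 + b *: perm_mx s2 + c *: perm_mx s3.

Lemma comb3E (R : realType) n (a b c : R) (s1 s2 s3 : 'S_n) i j :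
  comb3 a b c s1 s2 s3 i j =
  a * (s1 i == j)%:R + b * (s2 i == j)%:R + c * (s3 i == j)%:R.
Proof. by rewrite !mxE. Qed.

Lemma sum_mul_eq (R : realType) n (x y : 'I_n) :
  \sum_j (x == j)%:R * (y == j)%:R = (x == y)%:R :> R.
Proof.
rewrite (bigD1 x) //= eqxx mul1r big1 ?addr0 1?eq_sym // => j /negPf xj.
by rewrite eq_sym xj mul0r.
Qed.

Lemma orthogonal_mulmx_tr (R : realType) n (A : 'M[R]_n) :
  orthogonal_mx A -> A *m A^T = 1%:M.
Proof. exact: mulmx1C. Qed.

(** Bilinear expansion of the inner product of rows [i] and [j]. By injectivity, each permutation
    paired with itself contributes only when [i = j]. *)
Lemma comb3_dot (R : realType) n (a b c : R) (s1 s2 s3 : 'S_n) (i j : 'I_n) :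
  orthogonal_mx (comb3 a b c s1 s2 s3) ->
  (a ^+ 2 + b ^+ 2 + c ^+ 2) * (i == j)%:R
  + a * b * ((s1 i == s2 j)%:R + (s2 i == s1 j)%:R)
  + a * c * ((s1 i == s3 j)%:R + (s3 i == s1 j)%:R)
  + b * c * ((s2 i == s3 j)%:R + (s3 i == s2 j)%:R) = (i == j)%:R :> R.
Proof.
move=> /orthogonal_mulmx_tr /matrixP/(_ i j); rewrite [RHS]mxE => E.
rewrite -[RHS]E mxE.
under eq_bigr => k _ do
  rewrite [X in _ * X]mxE !comb3E !(mulrDl, mulrDr) !(mulrACA _ (_ == _)%:R).
rewrite !big_split /= -!mulr_sumr !sum_mul_eq !(inj_eq perm_inj).
ring.
Qed.

(** The transpose is the same combination of the inverse permutations, so both matrices multiply the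
    all-ones vector by [a + b + c]. *)
Lemma comb3_sum_sq (R : realType) n (a b c : R) (s1 s2 s3 : 'S_n.+1) :
  orthogonal_mx (comb3 a b c s1 s2 s3) -> (a + b + c) ^+ 2 = 1.
Proof.
have perm1 (s : 'S_n.+1) : perm_mx s *m const_mx 1 = const_mx 1 :> 'cV[R]_n.+1.
  by rewrite -row_permE; apply/matrixP => i j; rewrite !mxE.
have comb1 s t r : comb3 a b c s t r *m const_mx 1
    = (a + b + c) *: const_mx 1 :> 'cV[R]_n.+1.
  by rewrite !mulmxDl -!scalemxAl !perm1 !scalerDl.
have tr_comb : (comb3 a b c s1 s2 s3)^T = comb3 a b c s1^-1 s2^-1 s3^-1.
  by rewrite !linearD !linearZ /= !tr_perm_mx.
rewrite /orthogonal_mx tr_comb => /(congr1 (mulmx^~ (const_mx 1 : 'cV_n.+1))).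
rewrite -mulmxA mul1mx comb1 -scalemxAr comb1 scalerA -expr2.
by move=> /matrixP/(_ 0 0); rewrite !mxE mulr1.
Qed.

(** Subtracting the squared norm of row [i] from [(a + b + c) ^+ 2], both equal to 1, leaves twice
    this sum. *)
Lemma comb3_row (R : realType) n (a b c : R) (s1 s2 s3 : 'S_n.+1) i :
  orthogonal_mx (comb3 a b c s1 s2 s3) ->
  a * b * (s1 i != s2 i)%:R + a * c * (s1 i != s3 i)%:R
  + b * c * (s2 i != s3 i)%:R = 0.
Proof.
move=> orthA; have := comb3_sum_sq orthA; have := comb3_dot i i orthA.
rewrite eqxx !(eq_sym (s2 i) (s1 i)) !(eq_sym (s3 i)).
by do 3!case: (_ == _) => /=; move=> *; lra.
Qed.

(** If [f i = f j], rows [i] and [j] have inner product [d ^+ 2 = 1], so orthogonality makes [f]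
    injective, and [d] is 1 or -1. *)
Lemma signed_perm_mx (R : realType) n (A : 'M[R]_n) (d : R) (f : 'I_n -> 'I_n) :
    orthogonal_mx A -> d ^+ 2 = 1 ->
    (forall i j, A i j = d * (f i == j)%:R) ->
  is_perm_mx A \/ is_perm_mx (- A).
Proof.
move=> /orthogonal_mulmx_tr/matrixP AAT d2 Af.
have f_inj : injective f.
  move=> i j fij; have := AAT i j; rewrite !mxE.
  under eq_bigr => k _ do rewrite mxE !Af mulrACA -expr2 d2 mul1r.
  rewrite sum_mul_eq fij eqxx; case: eqVneq => // _ /eqP.
  by rewrite oner_eq0.
have AE : A = d *: perm_mx (perm f_inj).
  by apply/matrixP => i j; rewrite !mxE permE Af.
move/eqP: d2; rewrite sqrf_eq1 => /orP[] /eqP d1; [left|right].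
  by rewrite AE d1 scale1r perm_mx_is_perm.
by rewrite AE d1 scaleN1r opprK perm_mx_is_perm.
Qed.

(** * Rows with three distinct values cannot fill the whole matrix *)

Lemma mem_uniq4 (s : seq 'I_4) x : uniq s -> size s = 4 -> x \in s.
Proof.
move=> us ss; have sub : {subset s <= enum 'I_4} by move=> y _; rewrite mem_enum.
have [|_ ->] := uniq_min_size us sub; first by rewrite size_enum_ord ss.
by rewrite mem_enum.
Qed.

Lemma exists_missing (x y z : 'I_4) : exists m, m \notin [:: x; y; z].
Proof.
apply/existsP; apply: contraT; rewrite negb_exists => /forallP allin.
have sub : {subset enum 'I_4 <= [:: x; y; z]}.
  by move=> m _; have := allin m; rewrite negbK.
by have := uniq_leq_size (enum_uniq _) sub; rewrite size_enum_ord.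
Qed.

(** The triples are the columns reached by two rows, and [x'] is the column that the first row
    misses. Only three placements of [y'] and [z'] remain, and there the sum is [- v], [- u] or
    [2 w]. *)
Lemma missing_dot_neq0 (R : realType) (u v w : R) (x y z x' y' z' : 'I_4) :
    u != 0 -> v != 0 -> w != 0 -> u + v + w = 0 ->
    uniq [:: x; y; z; x'] -> uniq [:: x'; y'; z'] -> y != y' -> z != z' ->
  u * ((x == y')%:R + (y == x')%:R) + v * ((x == z')%:R + (z == x')%:R)
  + w * ((y == z')%:R + (z == y')%:R) != 0.
Proof.
move=> u0 v0 w0 uvw us us' yy' zz'.
have := mem_uniq4 z' us erefl; have := mem_uniq4 y' us erefl.
have neqF (p q : 'I_4) : p != q -> ((p == q) = false) * ((q == p) = false).
  by move=> pq; rewrite [q == p]eq_sym (negPf pq).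
move: us us'; rewrite /= !inE !negb_or.
move=> /and4P[/and3P[xy xz xx'] /andP[yz yx'] zx' _] /and3P[/andP[x'y' x'z'] y'z' _].
case/or4P=> /eqP Ey; case/or4P=> /eqP Ez; subst y' z';
  rewrite ?eqxx // in yy' zz' x'y' x'z' y'z' *;
  rewrite ?(neqF _ _ xy) ?(neqF _ _ xz) ?(neqF _ _ xx') ?(neqF _ _ yz)
    ?(neqF _ _ yx') ?(neqF _ _ zx') /=; apply/eqP => E;
  by first [ case/eqP: u0; lra | case/eqP: v0; lra | case/eqP: w0; lra ].
Qed.

Lemma comb3C12 (R : realType) n (a b c : R) (s1 s2 s3 : 'S_n) :
  comb3 a b c s1 s2 s3 = comb3 b a c s2 s1 s3.
Proof. by rewrite /comb3 [a *: _ + _]addrC. Qed.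

Lemma comb3C23 (R : realType) n (a b c : R) (s1 s2 s3 : 'S_n) :
  comb3 a b c s1 s2 s3 = comb3 a c b s1 s3 s2.
Proof. by rewrite /comb3 addrAC. Qed.

(** If [s1 j] were the column [m] missed by row [i], rows [i] and [j] would have a nonzero inner
    product. *)
Lemma comb3_missing_avoid (R : realType) (a b c : R) (s1 s2 s3 : 'S_4) i j m :
    orthogonal_mx (comb3 a b c s1 s2 s3) ->
    a * b != 0 -> a * c != 0 -> b * c != 0 ->
    (forall k, s1 k != s2 k) -> (forall k, s1 k != s3 k) ->
    (forall k, s2 k != s3 k) ->
    s1 i != m -> s2 i != m -> s3 i != m -> i != j ->
  s1 j != m.
Proof.
move=> orthA u0 v0 w0 d12 d13 d23 m1 m2 m3 ij; apply/eqP => mE.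
have uvw : a * b + a * c + b * c = 0.
  by have := comb3_row i orthA; rewrite d12 d13 d23 !mulr1.
have := comb3_dot i j orthA; rewrite (negPf ij) mulr0 add0r; apply/eqP.
apply: missing_dot_neq0; rewrite ?mE ?(inj_eq perm_inj) //=.
  by rewrite !inE !negb_or d12 d13 d23 m1 m2 m3.
by rewrite !inE !negb_or -mE d12 d13 d23.
Qed.

Lemma comb3_not_disjoint (R : realType) (a b c : R) (s1 s2 s3 : 'S_4) :
    orthogonal_mx (comb3 a b c s1 s2 s3) ->
    a * b != 0 -> a * c != 0 -> b * c != 0 ->
    (forall k, s1 k != s2 k) -> (forall k, s1 k != s3 k) ->
  ~ (forall k, s2 k != s3 k).
Proof.
move=> orthA u0 v0 w0 d12 d13 d23.
have sym (s t : 'S_4) : (forall k, s k != t k) -> forall k, t k != s k.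
  by move=> d k; rewrite eq_sym d.
have n01 : 0 != 1 :> 'I_4 by [].
have [m] := exists_missing (s1 0) (s2 0) (s3 0).
rewrite !inE !negb_or !(eq_sym m) => /and3P[m1 m2 m3].
(* The permutations differ everywhere, so they reach [m] in three distinct rows, none of them row 0.
   These fill the remaining rows, so row 1 is among them. *)
have uinv : uniq [:: 0; (s1^-1)%g m; (s2^-1)%g m; (s3^-1)%g m].
  have inv0 (s : 'S_4) : s 0 != m -> 0 != (s^-1)%g m.
    by apply: contraNneq => ->; rewrite permKV.
  have inv2 (s t : 'S_4) : (forall i, s i != t i) -> (s^-1)%g m != (t^-1)%g m.
    move=> /(_ ((s^-1)%g m)); apply: contraNneq => E.
    by rewrite permKV E permKV.
  by rewrite /= !inE !negb_or !inv0 // !inv2.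
have := mem_uniq4 1 uinv erefl; rewrite !inE /= => /or3P[] /eqP E1.
- have := comb3_missing_avoid orthA u0 v0 w0 d12 d13 d23 m1 m2 m3 n01.
  by rewrite E1 permKV eqxx.
(* Relabelling puts [s2], and in the last case [s3], in the role of the first permutation. *)
- rewrite comb3C12 in orthA.
  have := comb3_missing_avoid orthA _ w0 v0 (sym _ _ d12) d23 d13 m2 m1 m3
    n01.
  by rewrite E1 permKV eqxx mulrC => /(_ u0).
rewrite comb3C23 comb3C12 in orthA.
have := comb3_missing_avoid orthA _ _ u0 (sym _ _ d13) (sym _ _ d23) d12 m3 m1 m2
  n01.
by rewrite E1 permKV eqxx !(mulrC c) => /(_ v0 w0).
Qed.

(** * Cases that yield plus or minus a permutation matrix *)

Lemma comb3_signed_perm (R : realType) n (a b c : R) (s1 s2 s3 : 'S_n.+1) :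
    let A := comb3 a b c s1 s2 s3 in
    orthogonal_mx A -> a * b != 0 -> a * b + a * c = 0 -> a * b + b * c = 0 ->
    (forall i, ~~ uniq [:: s1 i; s2 i; s3 i]) ->
  is_perm_mx A \/ is_perm_mx (- A).
Proof.
move=> A orthA u0 uv uw nu.
have [a0 b0] : a != 0 /\ b != 0 by move: u0; rewrite mulf_eq0 negb_or => /andP[].
have cb : b = - c by apply: (mulfI a0); lra.
have ab : a = b by rewrite cb; apply: (mulfI b0); lra.
have d2 : b ^+ 2 = 1 by rewrite -(comb3_sum_sq orthA) ab; congr (_ ^+ 2); lra.
have w0 : a * c + b * c != 0.
  by apply: contra u0 => /eqP E; apply/eqP; lra.
(* With [a = b = - c], the term of [s3] cancels that of [s1] or [s2], and [f i] is the column of the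
   surviving one. A row with [s1 i = s2 i] different from [s3 i] would force [a * c + b * c = 0],
   against [w0]. *)
pose f i := if s1 i == s3 i then s2 i else s1 i.
apply: (@signed_perm_mx _ _ _ b f orthA d2).
move=> i j; rewrite comb3E ab /f; have := nu i; have := comb3_row i orthA.
rewrite /= !inE negb_or.
case: (eqVneq (s1 i) (s3 i)) => [->|d13] /=; first by move=> _ _; rewrite cb; lra.
case: (eqVneq (s2 i) (s3 i)) => [->|d23] /=; first by move=> _ _; rewrite cb; lra.
case: (eqVneq (s1 i) (s2 i)) => //= _; rewrite mulr0 add0r !mulr1 => E.
by rewrite E eqxx in w0.
Qed.

Lemma perm_neq_ex n (s t : 'S_n) : s <> t -> exists i, s i != t i.
Proof.
move=> st; apply/existsP; apply: contraT; rewrite negb_exists => /forallP E.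
by case: st; apply/permP => i; apply/eqP; rewrite -[_ == _]negbK.
Qed.

(** In a row where two given permutations differ, the third agrees with one of them, so one of two
    pair sums vanishes. No single pair sum serves all three choices of permutations, so at least two
    vanish; up to relabelling this is the preceding sign pattern. *)
Lemma comb3_no_uniq_row (R : realType) n (a b c : R) (s1 s2 s3 : 'S_n.+1) :
    let A := comb3 a b c s1 s2 s3 in
    orthogonal_mx A -> a * b != 0 -> a * c != 0 -> b * c != 0 ->
    s1 <> s2 -> s1 <> s3 -> s2 <> s3 ->
    (forall i, ~~ uniq [:: s1 i; s2 i; s3 i]) ->
  is_perm_mx A \/ is_perm_mx (- A).
Proof.
move=> A orthA u0 v0 w0.
move=> /perm_neq_ex[i12 d12] /perm_neq_ex[i13 d13] /perm_neq_ex[i23 d23] nu.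
have r12 : a * b + a * c = 0 \/ a * b + b * c = 0.
  have := comb3_row i12 orthA; have := nu i12; rewrite /= !inE d12 (negPf d12) /=.
  case: (eqVneq (s1 i12) (s3 i12)) => [<-|_] /=.
    by rewrite eq_sym d12 mulr0 addr0 !mulr1; right.
  by case: (_ == _) => //= _; rewrite mulr0 addr0 !mulr1; left.
have r13 : a * b + a * c = 0 \/ a * c + b * c = 0.
  have := comb3_row i13 orthA; have := nu i13; rewrite /= !inE d13 (negPf d13) orbF /=.
  case: (eqVneq (s1 i13) (s2 i13)) => [<-|_] /=.
    by rewrite d13 mulr0 add0r !mulr1; right.
  by case: (_ == _) => //= _; rewrite mulr0 addr0 !mulr1; left.
have r23 : a * b + b * c = 0 \/ a * c + b * c = 0.
  have := comb3_row i23 orthA; have := nu i23; rewrite /= !inE d23 /= andbT.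
  case: (eqVneq (s1 i23) (s2 i23)) => [->|_] /=.
    by rewrite d23 mulr0 add0r !mulr1; right.
  by case: (_ == _) => //= _; rewrite mulr0 addr0 !mulr1; left.
have nu' i : ~~ uniq [:: s1 i; s3 i; s2 i] /\ ~~ uniq [:: s3 i; s2 i; s1 i].
  split; have := nu i; rewrite /= !inE !(eq_sym (s3 i)) ?(eq_sym (s2 i) (s1 i));
    by case: (s1 i == s2 i); case: (s1 i == s3 i); case: (s2 i == s3 i).
have P12 : a * b + a * c = 0 -> a * b + b * c = 0 ->
    is_perm_mx A \/ is_perm_mx (- A).
  by move=> uv uw; exact: comb3_signed_perm.
have P13 : a * b + a * c = 0 -> a * c + b * c = 0 ->
    is_perm_mx A \/ is_perm_mx (- A).
  move=> uv vw; have AE : A = comb3 a c b s1 s3 s2 by rewrite /A comb3C23.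
  rewrite AE in orthA *; apply: comb3_signed_perm => //; [lra | lra |].
  by move=> i; case: (nu' i).
have P23 : a * b + b * c = 0 -> a * c + b * c = 0 ->
    is_perm_mx A \/ is_perm_mx (- A).
  move=> uw vw; have AE : A = comb3 c b a s3 s2 s1.
    by rewrite /A comb3C12 comb3C23 comb3C12.
  rewrite AE in orthA *; apply: comb3_signed_perm => //;
    [by rewrite mulrC | lra | lra |].
  by move=> i; case: (nu' i).
by case: r12 => E12; case: r13 => E13; case: r23 => E23; auto.
Qed.

(** A row where [s1] and [s2] differ gives [a * b = 0], so a single term survives, with coefficient
    of square 1. *)
Lemma comb2_signed_perm (R : realType) n (a b : R) (s1 s2 s3 : 'S_n.+1) :
    let A := comb3 a b 0 s1 s2 s3 in
    orthogonal_mx A -> s1 <> s2 -> is_perm_mx A \/ is_perm_mx (- A).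
Proof.
move=> A orthA /perm_neq_ex[i d12]; have sq := comb3_sum_sq orthA.
have := comb3_row i orthA; rewrite d12 !mulr0 !mul0r mulr1 !addr0.
move=> /eqP; rewrite mulf_eq0 => /orP[] /eqP z0.
  apply: (@signed_perm_mx _ _ _ b s2 orthA) => [|k j].
    by rewrite -sq z0 add0r addr0.
  by rewrite comb3E z0 !mul0r add0r addr0.
apply: (@signed_perm_mx _ _ _ a s1 orthA) => [|k j].
  by rewrite -sq z0 !addr0.
by rewrite comb3E z0 !mul0r !addr0.
Qed.

(** * Permutative blocks and the direct sum decomposition *)

Lemma permutative_rows (R : realType) n (B : 'M[R]_n) (r : seq R) :
    (forall i, perm_eq [seq B i j | j <- enum 'I_n] r) ->
  permutative_mx B.
Proof.
move=> Br i k.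
have /tuple_permP[s E] :
    perm_eq [tuple B i j | j < n] [tuple B k j | j < n].
  by rewrite (perm_trans (Br i)) // perm_sym; apply: Br.
exists s; apply/rowP => j; rewrite !mxE.
have /(congr1 (fun t : n.-tuple R => tnth t j)) := val_inj E.
by rewrite !tnth_mktuple.
Qed.

(** The three distinct columns [f i], [g i], [h i] exhaust ['I_3], so every row is a rearrangement
    of [a], [b], [c]. *)
Lemma latin_permutative (R : realType) (B : 'M[R]_3) (a b c : R)
    (f g h : 'I_3 -> 'I_3) :
    (forall i, uniq [:: f i; g i; h i]) ->
    (forall i j, B i j =
      a * (f i == j)%:R + b * (g i == j)%:R + c * (h i == j)%:R) ->
  permutative_mx B.
Proof.
move=> us BE; apply: (@permutative_rows _ _ _ [:: a; b; c]) => i.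
have sub : {subset [:: f i; g i; h i] <= enum 'I_3}.
  by move=> y _; rewrite mem_enum.
have [|_ eqm] := uniq_min_size (us i) sub; first by rewrite size_enum_ord.
have /(perm_map (B i)) := uniq_perm (us i) (enum_uniq _) eqm.
rewrite perm_sym => /perm_trans; apply; rewrite /= !BE !eqxx.
move: (us i); rewrite /= !inE negb_or => /and3P[/andP[fg fh] gh _].
rewrite !(eq_sym (h i)) (eq_sym (g i) (f i)) (negPf fg) (negPf fh) (negPf gh).
by rewrite !mulr0 !mulr1 !addr0 !add0r.
Qed.

Lemma comb3_block (R : realType) (a b c : R) (s1 s2 s3 : 'S_4) :
    let A := comb3 a b c s1 s2 s3 in
    orthogonal_mx A ->
    s1 ord_max = ord_max -> s2 ord_max = ord_max -> s3 ord_max = ord_max ->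
    (forall i, i != ord_max -> uniq [:: s1 i; s2 i; s3 i]) ->
  exists (B : 'M[R]_3) (C : 'M[R]_1),
    [/\ orthogonal_permutative_mx B, orthogonal_permutative_mx C &
        A = block_mx B 0 0 C :> 'M[R]_(3 + 1)].
Proof.
move=> A orthA m1 m2 m3 us.
have maxE : ord_max = rshift 3 ord0 :> 'I_(3 + 1) by apply: val_inj.
have lN (i : 'I_3) : @lshift 3 1 i != ord_max :> 'I_(3 + 1).
  by rewrite maxE eq_lrshift.
have eq_low (x y : 'I_3) : (@lshift 3 1 x == @lshift 3 1 y :> 'I_4) = (x == y).
  exact: (inj_eq (@lshift_inj 3 1)).
have low (s : 'S_4) : s ord_max = ord_max ->
    exists f : 'I_3 -> 'I_3, forall i, s (@lshift 3 1 i) = @lshift 3 1 (f i).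
  move=> sm; apply: (@fin_all_exists _ _
    (fun i x => s (@lshift 3 1 i) = @lshift 3 1 x)).
  move=> i; have : s (@lshift 3 1 i) != ord_max.
    by rewrite -[X in _ != X]sm (inj_eq perm_inj) lN.
  case: (split_ordP (s (@lshift 3 1 i) : 'I_(3 + 1))) => x ->; first by exists x.
  by rewrite maxE (ord1 x) eqxx.
have [f1 fE1] := low s1 m1; have [f2 fE2] := low s2 m2.
have [f3 fE3] := low s3 m3.
(* [M] is [A] with its order read as [3 + 1], so that the block operations apply. *)
pose M : 'M[R]_(3 + 1) := A.
have urM : ursubmx M = 0.
  apply/matrixP => i j; rewrite (ord1 j) !mxE -maxE -[RHS]/(0 : R).
  rewrite fE1 fE2 fE3 !(negPf (lN _)).
  by rewrite !mulr0 !addr0.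
have dlM : dlsubmx M = 0.
  apply/matrixP => i j; rewrite (ord1 i) !mxE -maxE m1 m2 m3.
  by rewrite (eq_sym ord_max) (negPf (lN _)) !mulr0 !addr0.
have ME : M = block_mx (ulsubmx M) 0 0 (drsubmx M).
  by rewrite -urM -dlM submxK.
have : M^T *m M = 1%:M := orthA.
rewrite ME tr_block_mx mulmx_block !trmx0 !mul0mx !mulmx0 !addr0 !add0r.
rewrite [1%:M](@scalar_mx_block _ 3 1) => /eq_block_mx[orthB _ _ orthC].
exists (ulsubmx M), (drsubmx M); split=> //.
  split=> //; apply: (@latin_permutative _ _ a b c f1 f2 f3) => [i|i j].
    have := us (@lshift 3 1 i) (lN i); rewrite fE1 fE2 fE3.
    rewrite -[X in uniq X]/(map (@lshift 3 1) [:: f1 i; f2 i; f3 i]).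
    by rewrite map_inj_uniq //; apply: lshift_inj.
  by rewrite !mxE fE1 fE2 fE3 !eq_low.
split=> // i k; exists 1%g; apply/rowP => j; rewrite !mxE.
by rewrite (ord1 i) (ord1 k) perm1.
Qed.

(** * Reordering rows and columns, and the final case analysis *)

Lemma orthogonal_mulmx (R : realType) n (A B : 'M[R]_n) :
  orthogonal_mx A -> orthogonal_mx B -> orthogonal_mx (A *m B).
Proof.
by move=> oA oB; rewrite /orthogonal_mx trmx_mul -mulmxA (mulmxA A^T) oA mul1mx.
Qed.

Lemma orthogonal_perm_mx (R : realType) n (s : 'S_n) :
  orthogonal_mx (perm_mx s : 'M[R]_n).
Proof. by rewrite /orthogonal_mx tr_perm_mx -perm_mxM mulVg perm_mx1. Qed.

Lemma perm_mx_comb3 (R : realType) n (a b c : R) (p q s1 s2 s3 : 'S_n) :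
  perm_mx p *m comb3 a b c s1 s2 s3 *m perm_mx q =
  comb3 a b c (p * s1 * q) (p * s2 * q) (p * s3 * q).
Proof.
by rewrite !mulmxDr !mulmxDl -!scalemxAr -!scalemxAl -!perm_mxM.
Qed.

Theorem theorem3p5 (R : realType) (A : 'M[R]_4)
    (hA : orthogonal_mx A)
    (hcomb : exists (P1 P2 P3 : 'M[R]_4) (a b c : R),
      [/\ is_perm_mx P1, is_perm_mx P2 & is_perm_mx P3] /\
      [/\ P1 <> P2, P1 <> P3 & P2 <> P3] /\
      A = a *: P1 + b *: P2 + c *: P3) :
  (is_perm_mx A \/ is_perm_mx (- A)) \/
  exists X Y : 'M[R]_4,
    [/\ is_perm_mx X, is_perm_mx Y &
      exists (B : 'M[R]_3) (C : 'M[R]_1),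
        [/\ orthogonal_permutative_mx B, orthogonal_permutative_mx C &
          X *m A *m Y = block_mx B 0 0 C :> 'M[R]_(3 + 1)]].
Proof.
have {hcomb}[s1 [s2 [s3 [a [b [c [n12 n13 n23 AE]]]]]]] :
    exists (s1 s2 s3 : 'S_4) a b c,
      [/\ s1 <> s2, s1 <> s3, s2 <> s3 & A = comb3 a b c s1 s2 s3].
  move: hcomb => [_ [_ [_ [a [b [c [[/is_perm_mxP[s1 ->] /is_perm_mxP[s2 ->]
    /is_perm_mxP[s3 ->]] [[n12 n13 n23] ->]]]]]]]].
  by exists s1, s2, s3, a, b, c; split=> // E; [case: n12|case: n13|case: n23];
    rewrite E.
subst A.
have [c0|c0] := eqVneq c 0.
  by left; rewrite c0 in hA *; apply: comb2_signed_perm.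
have [b0|b0] := eqVneq b 0.
  by left; rewrite b0 comb3C23 in hA *; apply: comb2_signed_perm.
have [a0|a0] := eqVneq a 0.
  by left; rewrite a0 comb3C12 comb3C23 in hA *; apply: comb2_signed_perm.
have u0 : a * b != 0 by rewrite mulf_neq0.
have v0 : a * c != 0 by rewrite mulf_neq0.
have w0 : b * c != 0 by rewrite mulf_neq0.
have [/existsP[k uk]|] := boolP [exists i, uniq [:: s1 i; s2 i; s3 i]]; last first.
  by rewrite negb_exists => /forallP nu; left; apply: comb3_no_uniq_row.
have uvw : a * b + a * c + b * c = 0.
  have := comb3_row k hA; move: uk; rewrite /= !inE negb_or andbT.
  by move=> /andP[/andP[-> ->] ->]; rewrite !mulr1.
(* Exactly two equal values would make a pair sum vanish, and then [uvw] would make the remaining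
   product vanish as well. *)
have row_type i : uniq [:: s1 i; s2 i; s3 i] \/ s1 i = s2 i /\ s1 i = s3 i.
  move: (comb3_row i hA); rewrite /= !inE negb_or andbT.
  case: (eqVneq (s1 i) (s2 i)) => [<-|d12].
    case: (eqVneq (s1 i) (s3 i)) => [<-|d13] /= E; first by right.
    by case/eqP: u0; lra.
  case: (eqVneq (s1 i) (s3 i)) => [<-|d13].
    by rewrite eq_sym (negPf d12) /= => E; case/eqP: v0; lra.
  case: (eqVneq (s2 i) (s3 i)) => [_|d23] /= E; last by left.
  by case/eqP: w0; lra.
have [/existsP[i0 /andP[/eqP e12 /eqP e13]]|] :=
    boolP [exists i, (s1 i == s2 i) && (s1 i == s3 i)]; last first.
  rewrite negb_exists => /forallP noteq; exfalso.
  have us i : [/\ s1 i != s2 i, s1 i != s3 i & s2 i != s3 i].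
    have := noteq i; case: (row_type i) => [|[-> ->]]; last by rewrite !eqxx.
    by rewrite /= !inE negb_or andbT => /andP[/andP[]].
  by apply: (comb3_not_disjoint hA) => // i; case: (us i).
(* [p] and [q] move the row [i0] and the column common to its three values to the last position. *)
right; set p := tperm i0 ord_max; set q := tperm (s1 i0) ord_max.
exists (perm_mx p), (perm_mx q); rewrite !perm_mx_is_perm; split=> //.
have orthXAY := orthogonal_mulmx
  (orthogonal_mulmx (orthogonal_perm_mx R p) hA) (orthogonal_perm_mx R q).
rewrite perm_mx_comb3 in orthXAY *.
apply: comb3_block => //; rewrite ?permM ?tpermR ?tpermL -?e12 -?e13 ?tpermL //.
move=> i iN; rewrite !permM.
rewrite -[X in uniq X]/(map q [:: s1 (p i); s2 (p i); s3 (p i)]).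
rewrite map_inj_uniq; last exact: perm_inj.
case: (row_type (p i)) => // -[f12 f13]; exfalso.
have pi_neq : p i != i0.
  by apply: contra iN => /eqP E; rewrite -(inj_eq (@perm_inj _ p)) E tpermR.
have ki0 : k != i0 by apply: contraTneq uk => ->; rewrite /= !inE e12 eqxx.
have kpi : k != p i by apply: contraTneq uk => ->; rewrite /= !inE f12 eqxx.
(* If row [p i] also had equal values, its column and those of row [k] would be all four columns.
   Then [s1 i0] would be one of them, which injectivity of each permutation excludes. *)
have u4 : uniq [:: s1 (p i); s1 k; s2 k; s3 k].
  rewrite cons_uniq uk andbT !inE !negb_or {2}f12 {2}f13.
  by rewrite !(inj_eq perm_inj) !(eq_sym (p i)) kpi.
have := mem_uniq4 (s1 i0) u4 erefl; rewrite !inE {3}e12 {3}e13 !(inj_eq perm_inj).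
by rewrite !(eq_sym i0) (negPf pi_neq) (negPf ki0).
Qed.
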